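(* Let $d\ge 2$, let $(\mathbb{R}^d,\|\cdot\|)$ be a $d$-dimensional Minkowski space, and let $T$ be a $d$-simplex with a circumcenter $M$. Then the Monge lines of $T$ (with respect to $M$) are concurrent in a single point $N_M$, i.e. there is exactly one point $N_M$ that lies on all Monge lines of $T$.
   Context: A Minkowski space $(\mathbb{R}^d,\|\cdot\|)$ is $\mathbb{R}^d$ with an arbitrary norm. A $d$-simplex is the convex hull $T=\mathrm{conv}\{A_0,\ldots,A_d\}$ of $d+1$ affinely independent points. A circumcenter of $T$ is a point $M$ for which there is $R>0$ with $\|A_i-M\|=R$ for all $i=0,\ldots,d$ (it need not exist and need not be unique). A ridge $F$ of $T$ is a $(d-2)$-face, i.e. the convex hull of $d-1$ of the vertices; its opposite edge $E_F$ is the segment joining the two remaining vertices. The centroid of a face is the arithmetic mean of its vertices; the centroid of $E_F$ is its midpoint. For each pair $(F,E_F)$ such that $M$ is not the midpoint of $E_F$, the associated Monge line is the line through the centroid of $F$ which is parallel to the line through $M$ and the midpoint of $E_F$. (If $M$ is the midpoint of $E_F$, no Monge line is associated to that pair.) *)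

(* Defs.v *)
From mathcomp Require Import all_boot all_order all_algebra.
From mathcomp Require Import boolp classical_sets reals convex.

Set Implicit Arguments.
Unset Strict Implicit.
Unset Printing Implicit Defensive.

Import Order.TTheory GRing.Theory Num.Theory.

Local Open Scope classical_set_scope.
Local Open Scope ring_scope.

(* The norm is an explicit function, since the canonical norm `|x| of 'rV[R]_d
   is the sup norm.  The fields are those of the factory Lmodule_isNormed. *)
Record is_norm (R : realType) (d : nat) (nrm : 'rV[R]_d -> R) : Prop := IsNorm {
  norm_triangle : forall x y, nrm (x + y) <= nrm x + nrm y;
  norm_homogeneous : forall (a : R) x, nrm (a *: x) = `|a| * nrm x;
  norm_definite : forall x, nrm x = 0 -> x = 0
}.

Definition affinely_independent (R : realType) (d : nat) (I : finType)
    (A : I -> 'rV[R]_d) : Prop :=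
  forall c : I -> R,
    \sum_i c i = 0 -> \sum_i c i *: A i = 0 -> forall i, c i = 0.

Definition convex_hull (R : realType) (d : nat) (S : set 'rV[R]_d) :
    set 'rV[R]_d :=
  smallest (fun C : set 'rV[R]_d => convex_set C) S.

Definition is_simplex (R : realType) (d : nat) (A : 'I_d.+1 -> 'rV[R]_d)
    (T : set 'rV[R]_d) : Prop :=
  affinely_independent A /\ T = convex_hull (range A).

Definition is_circumcenter (R : realType) (d : nat) (nrm : 'rV[R]_d -> R)
    (A : 'I_d.+1 -> 'rV[R]_d) (M : 'rV[R]_d) : Prop :=
  exists2 r : R, 0 < r & forall i, nrm (A i - M) = r.

(* A face of the simplex with vertices A is represented by the set F of the
   indices of its vertices; the face opposite to F is then ~: F. *)
Definition is_ridge (d : nat) (F : {set 'I_d.+1}) : Prop := #|F| = (d - 1)%N.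

Definition centroid (R : realType) (d : nat) (A : 'I_d.+1 -> 'rV[R]_d)
    (F : {set 'I_d.+1}) : 'rV[R]_d :=
  #|F|%:R^-1 *: \sum_(i in F) A i.

Definition line (R : realType) (d : nat) (p v : 'rV[R]_d) : set 'rV[R]_d :=
  [set p + t *: v | t in [set: R]].

Definition monge_lines (R : realType) (d : nat) (A : 'I_d.+1 -> 'rV[R]_d)
    (M : 'rV[R]_d) : set (set 'rV[R]_d) :=
  [set L | exists F : {set 'I_d.+1},
     [/\ is_ridge F, M <> centroid A (~: F)
       & L = line (centroid A F) (centroid A (~: F) - M)]].

(* Main.v *)
Require Import Defs.
From mathcomp Require Import all_boot all_order all_algebra.
From mathcomp Require Import boolp classical_sets reals convex.
From mathcomp Require Import zify ring.

(** Write [A_0, ..., A_d] for the vertices.  The common point has the closed form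
[[
  N = (A_0 + ... + A_d - 2 M) / (d - 1).
]]
If [F] is a ridge whose opposite edge has midpoint [m], then splitting the sum
over the vertices into [F] and the two remaining indices gives
[N = centroid F + 2 / (d - 1) (m - M)], so [N] is on every Monge line
([monge_point_on_line]).

For uniqueness, suppose that another point also lies on all Monge lines, and
let [u <> 0] be its difference with [N].  Two distinct points of a line
determine its direction, so [A_i + A_j - 2 M] is a multiple of [u] for all
[i <> j]; pairs without a Monge line satisfy this too, as the vector is then
zero ([edge_direction]).  Since [d >= 2] there are three distinct vertices
[A_i], [A_j], [A_k], and subtracting these relations shows that [A_i - A_k] and
[A_j - A_k] are multiples of the same vector [u].  The three vertices are thus
collinear, which contradicts affine independence
([affinely_independent_not_collinear]). *)

Local Open Scope ring_scope.
Import GRing.Theory Num.Theory.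

Section MongePoint.

Set Implicit Arguments.
Unset Strict Implicit.
Unset Printing Implicit Defensive.

Variables (R : realType) (d : nat).
Implicit Types (A : 'I_d.+1 -> 'rV[R]_d) (M : 'rV[R]_d) (F : {set 'I_d.+1}).

Definition monge_point A M : 'rV[R]_d :=
  (d - 1)%N%:R^-1 *: (\sum_i A i - 2 *: M).

Lemma card_ridge_opposite F : (1 <= d)%N -> is_ridge F -> #|~: F| = 2.
Proof.
by rewrite /is_ridge => d_gt0 cardF; have := cardsC F; rewrite card_ord; lia.
Qed.

Lemma monge_point_on_line A M F : (2 <= d)%N -> is_ridge F ->
  line (centroid A F) (centroid A (~: F) - M) (monge_point A M).
Proof.
move=> d_ge2 ridgeF; exists (2 / (d - 1)%N%:R) => //.
rewrite /monge_point /centroid (card_ridge_opposite (ltnW d_ge2) ridgeF) ridgeF.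
have -> : \sum_i A i = \sum_(i in F) A i + \sum_(i in ~: F) A i.
  by rewrite (bigID (mem F)) /=; congr (_ + _); apply: eq_bigl => i; rewrite inE.
have dR_neq0 : (d - 1)%N%:R != 0 :> R by rewrite pnatr_eq0; lia.
by apply/rowP => l; rewrite !mxE; field.
Qed.

(** The indicator form of the coefficients makes the two sums collapse
whether or not the indices are distinct. *)
Lemma affinely_independent3 A i j k (x y z : R) : affinely_independent A ->
  x + y + z = 0 -> x *: A i + y *: A j + z *: A k = 0 ->
  forall l, x * (l == i)%:R + y * (l == j)%:R + z * (l == k)%:R = 0.
Proof.
have sum_delta (V : lmodType R) (f : 'I_d.+1 -> V) (h : 'I_d.+1) (w : R) :
    \sum_l (w * (l == h)%:R) *: f l = w *: f h.
  rewrite (bigD1 h) //= eqxx mulr1 big1 ?addr0 // => l /negPf ->.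
  by rewrite mulr0 scale0r.
have sum_delta3 (V : lmodType R) (f : 'I_d.+1 -> V) :
    \sum_l (x * (l == i)%:R + y * (l == j)%:R + z * (l == k)%:R) *: f l =
    x *: f i + y *: f j + z *: f k.
  under eq_bigr do rewrite !scalerDl.
  by rewrite !big_split /= !sum_delta.
move=> indepA sum0 comb0; apply: indepA; last by rewrite sum_delta3.
have := sum_delta3 R^o (fun=> 1).
by rewrite /GRing.scale /= !mulr1 sum0; under eq_bigr do rewrite mulr1.
Qed.

Lemma affinely_independent_not_collinear A i j k (u : 'rV[R]_d) (a b : R) :
  affinely_independent A -> i != j -> j != k -> i != k ->
  A i - A k = a *: u -> A j - A k = b *: u -> False.
Proof.
move=> indepA nij njk nik Eik Ejk.
(* Eliminating u leaves an affine relation with coefficients b, -a, a - b. *)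
have rel : b *: A i + (- a) *: A j + (a - b) *: A k = 0.
  transitivity (b *: (A i - A k) - a *: (A j - A k)).
    by apply/rowP => l; rewrite !mxE; ring.
  by rewrite Eik Ejk !scalerA mulrC subrr.
have rel0 : b + (- a) + (a - b) = 0 by ring.
have := affinely_independent3 indepA rel0 rel j.
rewrite [j == i]eq_sym (negPf nij) (negPf njk) eqxx.
rewrite !mulr0 mulr1 add0r addr0 => /eqP; rewrite oppr_eq0 => /eqP a0.
(* The coefficient at A j shows a = 0, so that A i = A k. *)
have rel' : 1 *: A i + 0 *: A j + (- 1) *: A k = 0.
  by rewrite scale1r scale0r addr0 scaleN1r Eik a0 scale0r.
have rel0' : 1 + 0 + (- 1) = 0 :> R by ring.
have := affinely_independent3 indepA rel0' rel' i.
rewrite eqxx (negPf nij) (negPf nik) !mulr0 mulr1 !addr0.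
by move/eqP; rewrite oner_eq0.
Qed.

(** The line of the ridge opposite to the edge [A_i A_j] passes through [P] and
[Q], hence has direction [P - Q]; when [M] is the midpoint of the edge there is
no line, but then the scalar zero does. *)
Lemma edge_direction A M (P Q : 'rV[R]_d) i j : (1 <= d)%N -> i != j ->
  (forall L, monge_lines A M L -> L P) ->
  (forall L, monge_lines A M L -> L Q) ->
  P <> Q -> exists s : R, A i + A j - 2 *: M = s *: (P - Q).
Proof.
move=> d_gt0 nij onP onQ neqPQ.
pose F := ~: [set i; j].
have ridgeF : is_ridge F.
  have := cardsC [set i; j]; rewrite cards2 nij card_ord /is_ridge -/F /=.
  by rewrite add2n => -[Ed]; rewrite -[in RHS]Ed subn1.
have Emid : A i + A j - 2 *: M = 2 *: (centroid A (~: F) - M).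
  rewrite /centroid (card_ridge_opposite d_gt0 ridgeF) /F finset.setCK.
  rewrite big_setU1 ?inE //= big_set1.
  by apply/rowP => l; rewrite !mxE; field.
have [mid|not_mid] := pselect (M = centroid A (~: F)).
  by exists 0; rewrite Emid -mid subrr scaler0 scale0r.
have lineF : monge_lines A M (line (centroid A F) (centroid A (~: F) - M)).
  by exists F.
have [p _ EP] := onP _ lineF; have [q _ EQ] := onQ _ lineF.
have neq_pq : p - q != 0.
  by apply/eqP => /subr0_eq Epq; apply: neqPQ; rewrite -EP -EQ Epq.
exists (2 / (p - q)); rewrite Emid -EP -EQ.
by rewrite opprD addrACA subrr add0r -scalerBl scalerA divfK.
Qed.

End MongePoint.

Theorem theorem3p1 (R : realType) (d : nat) (hd : (2 <= d)%N)
    (nrm : 'rV[R]_d -> R) (hnrm : is_norm nrm)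
    (A : 'I_d.+1 -> 'rV[R]_d) (T : set 'rV[R]_d) (hT : is_simplex A T)
    (M : 'rV[R]_d) (hM : is_circumcenter nrm A M) :
  exists! N : 'rV[R]_d, forall L, monge_lines A M L -> L N.
Proof.
have onN L : monge_lines A M L -> L (monge_point A M).
  by move=> [F [ridgeF _ ->]]; exact: monge_point_on_line.
exists (monge_point A M); split=> // N' onN'.
apply: contrapT => neqN; have [indepA _] := hT.
have dir i j (nij : i != j) := edge_direction (ltnW hd) nij onN onN' neqN.
pose i0 : 'I_d.+1 := inord 0; pose i1 : 'I_d.+1 := inord 1.
pose i2 : 'I_d.+1 := inord 2.
have n01 : i0 != i1 by rewrite -val_eqE /= !inordK //; lia.
have n12 : i1 != i2 by rewrite -val_eqE /= !inordK //; lia.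
have n02 : i0 != i2 by rewrite -val_eqE /= !inordK //; lia.
have [s01 E01] := dir _ _ n01; have [s12 E12] := dir _ _ n12.
have [s02 E02] := dir _ _ n02.
have E02' : A i0 - A i2 = (s01 - s12) *: (monge_point A M - N').
  by rewrite scalerBl -E01 -E12; apply/rowP => l; rewrite !mxE; ring.
have E12' : A i1 - A i2 = (s01 - s02) *: (monge_point A M - N').
  by rewrite scalerBl -E01 -E02; apply/rowP => l; rewrite !mxE; ring.
exact: affinely_independent_not_collinear indepA n01 n12 n02 E02' E12'.
Qed.
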